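(* Let $K\subseteq\mathbb C^n$ be a nonempty compact set whose polynomial convex hull $\widehat K$ does not contain any isolated points, and let $A$ be a uniformly closed subalgebra of $C(K)$ with $P(K)\subseteq A\subseteq C(K)$. Then $A$ is not coherent.
   Context: $C(K)$ is the algebra of all continuous functions $K\to\mathbb C$ with pointwise operations and the supremum norm. $P(K)$ is the subalgebra of those functions in $C(K)$ that can be uniformly approximated on $K$ by holomorphic polynomials in $z_1,\dots,z_n$ (i.e. the closure in $C(K)$ of the restrictions of polynomials). The polynomial convex hull of $K$ is $\widehat K=\{z\in\mathbb C^n:|q(z)|\le\max_K|q|\text{ for all polynomials }q\in\mathbb C[z_1,\dots,z_n]\}$. A commutative unital ring is called coherent if the intersection of any two finitely generated ideals is finitely generated. *)

(* Defs.v *)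
From HB Require Import structures.
From mathcomp Require Import all_boot all_order all_algebra.
From mathcomp Require Import all_classical all_reals all_analysis.
From mathcomp Require Import complex.
(* Not imported: the notations of mpoly clash with those of mathcomp-analysis. *)
From mathcomp Require mpoly.

Set Implicit Arguments.
Unset Strict Implicit.
Unset Printing Implicit Defensive.

Import Order.TTheory GRing.Theory Num.Theory.
Import numFieldTopology.Exports numFieldNormedType.Exports.

Local Open Scope classical_set_scope.
Local Open Scope ring_scope.

Section Coherent.
Variable A : comPzRingType.

Definition ideal_span (m : nat) (g : 'I_m -> A) : set A :=
  [set x | exists c : 'I_m -> A, x = \sum_(i < m) c i * g i].

Definition finitely_generated (I : set A) : Prop :=
  exists (m : nat) (g : 'I_m -> A), I = ideal_span g.

Definition coherent : Prop := forall I J : set A,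
  finitely_generated I -> finitely_generated J -> finitely_generated (I `&` J).

End Coherent.

Section SubringOf.
Variables (V : comPzRingType) (A : set V) (A_subring : subring_closed [in A]).

(* The proof A_subring is unused in the carrier but lets the ring structure be
   inferred from the type. *)
Definition subring_of & subring_closed [in A] : Type := {x : V | x \in A}.

HB.instance Definition _ :=
  [isSub of subring_of A_subring for (sval : subring_of A_subring -> V)].
HB.instance Definition _ := [Choice of subring_of A_subring by <:].
HB.instance Definition _ :=
  GRing.SubChoice_isSubComPzRing.Build V [in A] (subring_of A_subring) A_subring.

End SubringOf.

(* Typed as a numClosedFieldType, so that C receives the topology and the
   C-module structure of numFieldNormedType; the instances declared directly
   on R[i] provide no topology. *)
Definition Cplx (R : realType) : numClosedFieldType := R[i].

Section FunctionAlgebras.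
Variables (R : realType) (n : nat).
Local Notation C := (Cplx R).

Definition peval (q : mpoly.mpoly n C) (z : 'rV[C]_n) : C :=
  mpoly.meval (z ord0) q.

(* The modulus |q w| has type C; its real part lives in R, where sup makes
   sense. *)
Definition poly_hull (K : set 'rV[C]_n) : set 'rV[C]_n :=
  [set z | forall q : mpoly.mpoly n C,
     complex.Re `|peval q z| <= sup [set complex.Re `|peval q w| | w in K]].

Variable K : set 'rV[C]_n.

Definition C_of : set (K -> C) := [set f | continuous f].

Definition polynomial_functions : set (K -> C) :=
  [set f | exists q : mpoly.mpoly n C, forall x : K, f x = peval q (\val x)].

Definition P_of : set (K -> C) :=
  C_of `&` closure (polynomial_functions : set {uniform K -> C}).

(* subalg_closed does not apply: K -> C is only a possibly trivial ring, as
   nothing forces K to be nonempty here. *)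
Definition subalgebra (A : set (K -> C)) : Prop :=
  subring_closed [in A] /\ GRing.scaler_closed [in A].

Definition uniformly_closed (A : set (K -> C)) : Prop :=
  closed (A : set {uniform K -> C}).

End FunctionAlgebras.

Arguments C_of {R n} K _.
Arguments polynomial_functions {R n} K _.
Arguments P_of {R n} K _.

(* Main.v *)
(* Choose x in K of maximal Euclidean norm and an affine polynomial w vanishing
   at x with |w|^2 <= Re w on K, so that 1 - w peaks exactly at x. If x were
   isolated in K, powers of 1 - w would show that it is isolated in the polynomial
   hull; hence w takes arbitrarily small nonzero values on K.
   The functions e_N = 1 / (1 + N w), N >= 0, belong to A. For a fast growing
   sequence N_j the product theta of the Cayley transforms 1 - 2 e_{N_j} is bounded
   and alternates between values near 1 and -1 along points y_j tending to x, and
   g = theta w belongs to A. If g k = w a with k, a in A, the oscillation of theta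
   forces k(x) = 0. So if (w) and (g) had a finitely generated intersection, its
   generators would be g k_i with k_i(x) = 0. For a series
   h = sum_j 2^-j (1 - e_{n_j}) one has g h in (w), hence |h| <= C sum_i |k_i| at the
   points y_j; but n_j can be chosen so that h tends to 0 more slowly than that. *)
Require Import Defs.
From mathcomp Require Import all_boot all_order all_algebra.
From mathcomp Require Import all_classical all_reals all_analysis.
From mathcomp Require Import complex ring lra zify.
(* Only the instances, as the notations of mpoly clash with those of
   mathcomp-analysis. *)
From mathcomp Require Import (canonicals) mpoly.

Set Implicit Arguments.
Unset Strict Implicit.
Unset Printing Implicit Defensive.

Import Order.TTheory GRing.Theory Num.Theory.
Import numFieldTopology.Exports numFieldNormedType.Exports.

Local Open Scope classical_set_scope.
Local Open Scope ring_scope.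

(** * The modulus as a real number *)

Definition cmod (R : realType) (z : Cplx R) : R := complex.Re `|z|.

(* Re and the embedding of R retyped on Cplx R, which unification does not
   identify with R[i]. *)
Definition cre (R : realType) (z : Cplx R) : R := complex.Re z.

Definition ofR (R : realType) (x : R) : Cplx R := real_complex R x.

Section Modulus.
Variable R : realType.
Implicit Types (u v z : Cplx R) (x : R).

Lemma norm_cmod z : `|z| = ofR (cmod z).
Proof. by []. Qed.

Lemma cmod_ge0 z : 0 <= cmod z.
Proof. by have := normr_ge0 z; rewrite lecE => /andP[]. Qed.

Lemma cmodM u v : cmod (u * v) = cmod u * cmod v.
Proof. exact: Normc.normcM. Qed.

Lemma cmodD u v : cmod (u + v) <= cmod u + cmod v.
Proof. exact: le_normcD. Qed.

Lemma cmodN z : cmod (- z) = cmod z.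
Proof. by rewrite /cmod normrN. Qed.

Lemma cmodV z : cmod z^-1 = (cmod z)^-1.
Proof. exact: Normc.normcV. Qed.

Lemma cmod0 : cmod (0 : Cplx R) = 0.
Proof. exact: Normc.normc0. Qed.

Lemma cmod1 : cmod (1 : Cplx R) = 1.
Proof. exact: Normc.normc1. Qed.

Lemma cmodX z n : cmod (z ^+ n) = cmod z ^+ n.
Proof. by elim: n => [|n IHn]; rewrite ?cmod1// !exprS cmodM IHn. Qed.

Lemma cmod_eq0 z : (cmod z == 0) = (z == 0).
Proof.
by apply/eqP/eqP => [|->]; [exact: Normc.eq0_normc|exact: cmod0].
Qed.

Lemma cmod_gt0 z : (0 < cmod z) = (z != 0).
Proof. by rewrite lt_def cmod_ge0 andbT cmod_eq0. Qed.

Lemma cmodB u v : cmod (u - v) = cmod (v - u).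
Proof. by rewrite -cmodN opprB. Qed.

Lemma cmod_triangle u v z : cmod (u - z) <= cmod (u - v) + cmod (v - z).
Proof. by rewrite (_ : u - z = (u - v) + (v - z)) ?cmodD//; ring. Qed.

Lemma sqr_cmod z : cmod z ^+ 2 = cre z ^+ 2 + complex.Im z ^+ 2.
Proof.
by case: z => a b; rewrite /cmod /= sqr_sqrtr// addr_ge0// sqr_ge0.
Qed.

Lemma cmod_ofR x : cmod (ofR x) = `|x|.
Proof. by rewrite /cmod /= expr0n addr0 sqrtr_sqr. Qed.

Lemma ofRM x1 x2 : ofR (x1 * x2) = ofR x1 * ofR x2.
Proof. exact: rmorphM. Qed.

Lemma ofR2 : ofR 2 = 2 :> Cplx R.
Proof. exact: rmorph_nat. Qed.

Lemma normr_le_sqr (a b : R) : 0 <= b -> a ^+ 2 <= b ^+ 2 -> `|a| <= b.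
Proof.
move=> b0 ab; rewrite -(ler_pXn2r (n := 2)) ?nnegrE//.
by rewrite -normrX ger0_norm ?sqr_ge0.
Qed.

Lemma cmod_sqr_le u x : 0 <= x -> cre u ^+ 2 + complex.Im u ^+ 2 <= x ^+ 2 ->
  cmod u <= x.
Proof.
move=> x0; rewrite -sqr_cmod => /(normr_le_sqr x0).
by rewrite ger0_norm ?cmod_ge0.
Qed.

Lemma cre_le z : `|cre z| <= cmod z.
Proof.
apply: normr_le_sqr; first exact: cmod_ge0.
by rewrite sqr_cmod lerDl sqr_ge0.
Qed.

Lemma cim_le z : `|complex.Im z| <= cmod z.
Proof.
apply: normr_le_sqr; first exact: cmod_ge0.
by rewrite sqr_cmod lerDr sqr_ge0.
Qed.

Lemma cmod_le_reim z : cmod z <= `|cre z| + `|complex.Im z|.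
Proof.
apply: cmod_sqr_le; first by rewrite addr_ge0.
rewrite sqrrD -!normrX !(ger0_norm (sqr_ge0 _)) lerD2r lerDl.
by rewrite mulrn_wge0// mulr_ge0.
Qed.

Lemma creD u v : cre (u + v) = cre u + cre v.
Proof. by case: u => a b; case: v. Qed.

Lemma creN u : cre (- u) = - cre u.
Proof. by case: u. Qed.

Lemma cre1 : cre (1 : Cplx R) = 1.
Proof. by []. Qed.

Lemma creMl x z : cre (ofR x * z) = x * cre z.
Proof. by case: z => a b; rewrite /cre /= mul0r subr0. Qed.

Lemma cimMl x z : complex.Im (ofR x * z) = x * complex.Im z.
Proof. by case: z => a b; rewrite /= mul0r addr0. Qed.

Lemma cimD u v : complex.Im (u + v) = complex.Im u + complex.Im v.
Proof. by case: u => a b; case: v. Qed.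

Lemma cmod_sum (I : Type) (r : seq I) (P : pred I) (F : I -> Cplx R) :
  cmod (\sum_(i <- r | P i) F i) <= \sum_(i <- r | P i) cmod (F i).
Proof.
apply: (big_ind2 (fun a b => cmod a <= b)) => //; first by rewrite cmod0.
by move=> a b c d ab cd; apply: le_trans (cmodD _ _) (lerD ab cd).
Qed.

Lemma cmod_prod (I : Type) (r : seq I) (P : pred I) (F : I -> Cplx R) :
  cmod (\prod_(i <- r | P i) F i) = \prod_(i <- r | P i) cmod (F i).
Proof. by apply: (big_morph _ cmodM); exact: cmod1. Qed.

Lemma cmod_arbitrarily_small z :
  (forall e : R, 0 < e -> cmod z <= e) -> z = 0.
Proof.
move=> ze; apply/eqP; rewrite -cmod_eq0 eq_le cmod_ge0 andbT.
by apply/ler_addgt0Pr => e e0; rewrite add0r ze.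
Qed.

(** The intervals [s_j - B_j, s_j + B_j] are nested, so the supremum of their left ends lies in all
    of them. *)
Lemma nested_limit (s B : nat -> R) :
  (forall j, `|s j.+1 - s j| <= B j - B j.+1) -> (forall j, 0 <= B j) ->
  exists l, forall j, `|l - s j| <= B j.
Proof.
move=> sB B0.
have mono i k : s i - B i <= s (i + k)%N - B (i + k)%N /\
    s (i + k)%N + B (i + k)%N <= s i + B i.
  elim: k => [|k [IH1 IH2]]; first by rewrite addn0.
  by rewrite addnS; have := sB (i + k)%N; rewrite ler_norml => /andP[*]; lra.
have cross i j : s i - B i <= s j + B j.
  have := B0 i; have := B0 j.
  case/orP: (leq_total i j) => /subnKC <-.
    by have [*] := mono i (j - i)%N; lra.
  by have [*] := mono j (i - j)%N; lra.
pose E := range (fun i => s i - B i).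
have E0 : E !=set0 by exists (s 0%N - B 0%N), 0%N.
exists (sup E) => j; rewrite ler_distl; apply/andP; split.
  apply: ub_le_sup; last by exists j.
  by exists (s 0%N + B 0%N) => _ [i _ <-].
by apply: ge_sup => // _ [i _ <-].
Qed.

(** The real and imaginary parts are treated separately; |z| <= |Re z| + |Im z| produces the factor
    2. *)
Lemma complex_nested_limit (s : nat -> Cplx R) (B : nat -> R) :
  (forall j, cmod (s j.+1 - s j) <= B j - B j.+1) -> (forall j, 0 <= B j) ->
  exists l, forall j, cmod (l - s j) <= B j *+ 2.
Proof.
move=> sB B0.
have [j|a Ha] := @nested_limit (fun j => cre (s j)) B _ B0.
  by rewrite -creN -creD (le_trans (cre_le _)).
have [j|b Hb] := @nested_limit (fun j => complex.Im (s j)) B _ B0.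
  apply: le_trans (sB j); apply: le_trans (cim_le _).
  by case: (s j) => ? ?; case: (s j.+1).
exists (Complex a b : Cplx R) => j; apply: le_trans (cmod_le_reim _) _.
by rewrite mulr2n lerD//; [have := Ha j|have := Hb j]; case: (s j).
Qed.

End Modulus.

(** * Resolvents *)

Section Resolvent.
Variable R : realType.
Implicit Types (w : Cplx R) (n : R).

Definition resolvent n w : Cplx R := (1 + ofR n * w)^-1.

Section Bounds.
Variables (n : R) (w : Cplx R).
Hypotheses (n_ge0 : 0 <= n) (w_ge0 : 0 <= cre w).

Let den_sqr : cmod (1 + ofR n * w) ^+ 2 =
  (1 + n * cre w) ^+ 2 + (n * complex.Im w) ^+ 2.
Proof. by rewrite sqr_cmod creD cimD cre1 creMl cimMl add0r. Qed.

(** This bound and [resolvent_den_ge] follow from |1 + n w|^2 = 1 + 2 n Re w + n^2 |w|^2, where all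
    terms are nonnegative. *)
Lemma resolvent_den_ge1 : 1 <= cmod (1 + ofR n * w).
Proof.
have nw := mulr_ge0 n_ge0 w_ge0; have i0 := sqr_ge0 (n * complex.Im w).
rewrite -[leLHS]normr1; apply: normr_le_sqr; first exact: cmod_ge0.
by rewrite den_sqr; nra.
Qed.

Lemma resolvent_den_neq0 : 1 + ofR n * w != 0.
Proof. by rewrite -cmod_gt0; apply: lt_le_trans resolvent_den_ge1. Qed.

Lemma resolvent_den_ge : n * cmod w <= cmod (1 + ofR n * w).
Proof.
have nw := mulr_ge0 n_ge0 w_ge0.
rewrite -[leLHS]ger0_norm ?mulr_ge0 ?cmod_ge0//.
apply: normr_le_sqr; first exact: cmod_ge0.
by rewrite den_sqr exprMn sqr_cmod; nra.
Qed.

Lemma cmod_resolvent_le1 : cmod (resolvent n w) <= 1.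
Proof.
rewrite cmodV invf_le1 ?resolvent_den_ge1//.
exact: lt_le_trans resolvent_den_ge1.
Qed.

Lemma cmod_resolvent_le : n * cmod w * cmod (resolvent n w) <= 1.
Proof.
rewrite cmodV ler_pdivrMr ?mul1r ?resolvent_den_ge//.
exact: lt_le_trans resolvent_den_ge1.
Qed.

Lemma one_sub_resolvent : 1 - resolvent n w = ofR n * w * resolvent n w.
Proof.
rewrite /resolvent; have := resolvent_den_neq0; set d := 1 + _ => d0.
by rewrite (_ : ofR n * w = d - 1) ?mulrBl ?divff ?mul1r// /d; ring.
Qed.

Lemma cmod_one_sub_resolvent : cmod (1 - resolvent n w) <= n * cmod w.
Proof.
rewrite one_sub_resolvent cmodM cmodM cmod_ofR ger0_norm//.
by rewrite ler_piMr ?mulr_ge0 ?cmod_ge0// cmod_resolvent_le1.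
Qed.

Lemma cmod_one_sub_resolvent_le1 : cmod (1 - resolvent n w) <= 1.
Proof.
rewrite one_sub_resolvent !cmodM cmod_ofR ger0_norm//.
exact: cmod_resolvent_le.
Qed.

(* The Cayley transform maps the right half-plane into the unit disc. *)
Lemma cmod_cayley : cmod (1 - resolvent n w *+ 2) <= 1.
Proof.
have nw := mulr_ge0 n_ge0 w_ge0.
rewrite (_ : 1 - _ = (ofR n * w - 1) * resolvent n w); last first.
  by rewrite mulrBl -one_sub_resolvent; ring.
rewrite cmodM cmodV ler_pdivrMr ?mul1r; last first.
  exact: lt_le_trans resolvent_den_ge1.
apply: cmod_sqr_le; first exact: cmod_ge0.
rewrite den_sqr creD cimD creN cre1 creMl cimMl.
by rewrite (_ : complex.Im (-1) = 0) /= ?oppr0// addr0; nra.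
Qed.

End Bounds.
End Resolvent.

Lemma geometric_small (R : realType) (q e : R) : 0 <= q < 1 -> 0 < e ->
  exists k, q ^+ k < e.
Proof.
move=> /andP[q0 q1] e0.
have /cvgrPdist_lt /(_ e e0) [k _ /(_ k (leqnn k))] : (fun k => q ^+ k) @ \oo --> (0:R).
  by apply: cvg_expr; rewrite ger0_norm.
by rewrite sub0r normrN ger0_norm ?exprn_ge0// => ?; exists k.
Qed.

(** * Uniformly closed algebras *)

Section UniformLimits.
Variables (R : realType) (X : Type) (A : set (X -> Cplx R)).
Hypothesis A_subring : subring_closed [in A].
Hypothesis A_scaler : GRing.scaler_closed [in A].
(** Uniform closedness in epsilon form, so that [X] can be a bare type. *)
Hypothesis A_uniform : forall F : X -> Cplx R,
  (forall e : R, 0 < e -> exists2 a, A a & forall y, cmod (F y - a y) <= e) ->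
  A F.

Lemma algebra1 : A (fun=> 1).
Proof. by have [+ _ _] := A_subring; rewrite inE. Qed.

Lemma algebraB f g : A f -> A g -> A (fun y => f y - g y).
Proof.
by move=> Af Ag; have [_ + _] := A_subring => /(_ f g); rewrite !inE; exact.
Qed.

Lemma algebraM f g : A f -> A g -> A (fun y => f y * g y).
Proof.
by move=> Af Ag; have [_ _ +] := A_subring => /(_ f g); rewrite !inE; exact.
Qed.

Lemma algebraZ c f : A f -> A (fun y => c * f y).
Proof. by move=> Af; have := @A_scaler c f; rewrite !inE; exact. Qed.

Lemma algebra0 : A (fun=> 0).
Proof.
have := algebraB algebra1 algebra1; congr (A _).
by apply/funext => y; rewrite subrr.
Qed.

Lemma algebraD f g : A f -> A g -> A (fun y => f y + g y).
Proof.
move=> Af Ag; have := algebraB Af (algebraB algebra0 Ag); congr (A _).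
by apply/funext => y; rewrite sub0r opprK.
Qed.

Lemma algebraX f n : A f -> A (fun y => f y ^+ n).
Proof.
move=> Af; elim: n => [|n IHn]; first exact: algebra1.
have := algebraM Af IHn; congr (A _).
by apply/funext => y; rewrite exprS.
Qed.

Lemma algebra_sum n (F : nat -> X -> Cplx R) : (forall i, A (F i)) ->
  A (fun y => \sum_(i < n) F i y).
Proof.
move=> AF; elim: n => [|n IHn].
  by have := algebra0; congr (A _); apply/funext => y; rewrite big_ord0.
have := algebraD IHn (AF n); congr (A _).
by apply/funext => y; rewrite big_ord_recr.
Qed.

Lemma algebra_prod n (F : nat -> X -> Cplx R) : (forall i, A (F i)) ->
  A (fun y => \prod_(i < n) F i y).
Proof.
move=> AF; elim: n => [|n IHn].
  by have := algebra1; congr (A _); apply/funext => y; rewrite big_ord0.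
have := algebraM IHn (AF n); congr (A _).
by apply/funext => y; rewrite big_ord_recr.
Qed.

(** The telescoping bounds make the [a j] uniformly Cauchy. The error is recorded for every [j],
    because later estimates depend on its explicit size. *)
Lemma algebra_limit (a : nat -> X -> Cplx R) (B : nat -> R) :
  (forall j, A (a j)) ->
  (forall j y, cmod (a j.+1 y - a j y) <= B j - B j.+1) ->
  (forall j, 0 <= B j) -> (forall e, 0 < e -> exists j, B j < e) ->
  exists2 f, A f & forall j y, cmod (f y - a j y) <= B j *+ 2.
Proof.
move=> Aa aB B0 Bsmall.
have /choice[f Hf] : forall y, exists l, forall j, cmod (l - a j y) <= B j *+ 2.
  by move=> y; apply: complex_nested_limit.
exists f => //; apply: A_uniform => e e0.
have [|j Bj] := Bsmall (e / 2); first by rewrite divr_gt0.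
exists (a j) => // y; apply: le_trans (Hf y j) _.
by rewrite mulr2n; lra.
Qed.

(* 1 + n w = (1 + n) (1 - r p) with p = 1 - w and r = n / (1 + n) < 1, so the
   resolvent is a uniformly convergent geometric series in p. *)
Lemma algebra_resolvent n (w : X -> Cplx R) : 0 <= n -> A w ->
  (forall y, 0 <= cre (w y)) -> (forall y, cmod (1 - w y) <= 1) ->
  A (fun y => resolvent n (w y)).
Proof.
move=> n0 Aw w0 w1; apply: A_uniform => e e0.
have n1 : 0 < 1 + n by lra.
pose r := n / (1 + n).
have r01 : 0 <= r < 1.
  by rewrite divr_ge0 ?(ltW n1)//= ltr_pdivrMr// mul1r; lra.
have [k rk] := geometric_small r01 e0.
have /andP[r0 _] := r01.
exists (fun y => ofR (1 + n)^-1 * \sum_(i < k) (ofR r * (1 - w y)) ^+ i).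
  apply: algebraZ; apply: (@algebra_sum k (fun i y => (ofR r * (1 - w y)) ^+ i)) => i.
  apply: (@algebraX (fun y => ofR r * (1 - w y))).
  by apply: algebraZ; apply: (algebraB algebra1).
move=> y; set q := ofR r * (1 - w y).
have q1 : ofR (1 + n) * (1 - q) = 1 + ofR n * w y.
  rewrite /q mulrBr mulr1 mulrA /ofR -rmorphM /= /r mulrCA divff ?gt_eqF// mulr1.
  by rewrite rmorphD /= rmorph1; ring.
have qd : 1 + ofR n * w y != 0 by apply: resolvent_den_neq0.
have qk : (1 - q) * (\sum_(i < k) q ^+ i) = 1 - q ^+ k.
  rewrite -[1 in RHS](expr1n _ k) subrXX; congr (_ * _).
  by apply: eq_bigr => i _; rewrite expr1n mul1r.
(* The remainder of the geometric series; |q| <= r makes it at most r^k. *)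
have -> : resolvent n (w y) - ofR (1 + n)^-1 * (\sum_(i < k) q ^+ i) =
    q ^+ k * resolvent n (w y).
  apply: (mulfI qd); rewrite mulrBr [in RHS]mulrCA /resolvent divff// mulr1 -q1.
  rewrite mulrACA qk /ofR -rmorphM divff ?gt_eqF//= rmorph1; ring.
rewrite cmodM cmodX /q cmodM cmod_ofR ger0_norm//.
apply: le_trans (ltW rk).
rewrite exprMn -mulrA ler_piMr ?exprn_ge0//.
rewrite mulr_ile1 ?cmod_ge0 ?exprn_ge0 ?cmod_resolvent_le1 ?cmod_ge0//.
by rewrite exprn_ile1// cmod_ge0.
Qed.

End UniformLimits.

(** * Oscillating multiples of w *)

Section Oscillation.
Variables (R : realType) (X : Type) (A : set (X -> Cplx R)).
Hypothesis A_subring : subring_closed [in A].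
Hypothesis A_scaler : GRing.scaler_closed [in A].
Hypothesis A_uniform : forall F : X -> Cplx R,
  (forall e : R, 0 < e -> exists2 a, A a & forall y, cmod (F y - a y) <= e) ->
  A F.
Variables (w : X -> Cplx R).
Hypothesis Aw : A w.
Hypothesis w_ge0 : forall y, 0 <= cre (w y).
Hypothesis w_disc : forall y, cmod (1 - w y) <= 1.

(** [g] is the limit of w times the finite products of Cayley transforms. The factor w forces
    uniform convergence, as |w e_N| <= 1/N; the bare products alternate in sign at zeros of w. *)
Lemma oscillating_function :
  (forall e : R, 0 < e -> exists y, 0 < cmod (w y) < e) ->
  exists (g : X -> Cplx R) (y : nat -> X),
    [/\ A g, forall z, cmod (g z) <= cmod (w z),
        forall j, 0 < cmod (w (y j)) <= (256^-1) ^+ j &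
        forall j, cmod (g (y j) - (-1) ^+ j * w (y j)) <= cmod (w (y j)) / 2].
Proof.
move=> accum.
have /choice[Y HY] : forall e : R, exists y, 0 < e -> 0 < cmod (w y) < e.
  (* For e <= 0 any point will do. *)
  move=> e; have [e0|e0] := pselect (0 < e); last first.
    by have [y _] := accum 1 ltr01; exists y.
  by have [y] := accum _ e0; exists y.
pose fix y j := if j is i.+1 then Y (cmod (w (y i)) / 256) else Y 1.
pose tau j := cmod (w (y j)).
have tau0 j : 0 < tau j.
  rewrite /tau; elim: j => [|j IHj]; first by have /andP[] := HY 1 ltr01.
  by have /andP[] := HY _ (divr_gt0 IHj (ltr0n _ 256)).
have tauS j : tau j.+1 < tau j / 256.
  by have /andP[] := HY _ (divr_gt0 (tau0 j) (ltr0n _ 256)).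
have tau_le j : tau j <= (256^-1) ^+ j.
  elim: j => [|j IHj]; first by have /andP[_ /ltW] := HY 1 ltr01.
  apply: le_trans (ltW (tauS j)) _; by rewrite exprS; lra.
(* At y_j the resolvent e_{N_i} is close to 1 for i < j and to 0 for i >= j. *)
pose N j := 16 / tau j.
have N0 j : 0 < N j by rewrite divr_gt0.
have NS j : 256 * N j <= N j.+1.
  have H := tauS j; have H0 := tau0 j; have H1 := tau0 j.+1.
  rewrite /N ler_pdivlMr// (_ : _ * _ = 16 * 256 * tau j.+1 / tau j); last ring.
  by rewrite ler_pdivrMr//; lra.
pose m j z : Cplx R := 1 - resolvent (N j) (w z) *+ 2.
pose theta J z := \prod_(i < J) m i z.
have m1 j z : cmod (m j z) <= 1 by apply: cmod_cayley; rewrite // ltW.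
have theta1 J z : cmod (theta J z) <= 1.
  by rewrite /theta cmod_prod prodr_ile1// => i _; rewrite cmod_ge0 m1.
(* Each factor adds an error of at most 2 N_j |w|, and 1/100 + 2 <= 256/100 lets the growth of [N]
   absorb it. *)
have theta_near j z : cmod (theta j z - (-1) ^+ j) <= N j * cmod (w z) / 100.
  elim: j => [|j IHj].
    rewrite /theta big_ord0 subrr cmod0 divr_ge0// mulr_ge0 ?cmod_ge0//.
    exact: ltW.
  have mz : cmod (m j z + 1) <= 2 * (N j * cmod (w z)).
    rewrite (_ : m j z + 1 = ofR 2 * (1 - resolvent (N j) (w z))); last first.
      by rewrite ofR2 /m; ring.
    rewrite cmodM cmod_ofR ger0_norm// ler_pM2l//.
    by rewrite cmod_one_sub_resolvent// ltW.
  rewrite /theta big_ord_recr /= -/(theta j z) exprS.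
  rewrite (_ : _ - _ = (theta j z - (-1) ^+ j) * m j z +
    (-1) ^+ j * (m j z + 1)); last ring.
  apply: le_trans (cmodD _ _) _; rewrite !cmodM cmodX cmodN cmod1 expr1n mul1r.
  have h1 : cmod (theta j z - (-1) ^+ j) * cmod (m j z) <=
      cmod (theta j z - (-1) ^+ j) by rewrite ler_piMr ?cmod_ge0.
  have h2 := ler_wpM2r (cmod_ge0 (w z)) (NS j).
  have h3 : 0 <= N j * cmod (w z) by rewrite mulr_ge0 ?cmod_ge0 ?ltW.
  by lra.
pose a J z := w z * theta J z.
have Aa J : A (a J).
  apply: algebraM => //; apply: (@algebra_prod _ _ _ A_subring J m) => i.
  apply: algebraB => //; first exact: algebra1.
  have AN : A (fun z => resolvent (N i) (w z)).
    by apply: algebra_resolvent => //; exact: ltW.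
  exact: (algebraD A_subring AN AN).
have a_le J z : cmod (a J z) <= cmod (w z).
  by rewrite /a cmodM ler_piMr ?cmod_ge0.
(* The increments of [a] are at most tau_j / 8, which is below (9/64) (1 - 1/256) tau_j. *)
pose B j := 9 / 64 * tau j.
have aB j z : cmod (a j.+1 z - a j z) <= B j - B j.+1.
  rewrite (_ : _ - _ = - (a j z * (ofR 2 * resolvent (N j) (w z)))); last first.
    by rewrite /a /theta big_ord_recr /= /m ofR2; ring.
  rewrite cmodN (cmodM (a j z)) (cmodM (ofR 2)) cmod_ofR ger0_norm//.
  have h1 : cmod (w z) * cmod (resolvent (N j) (w z)) <= tau j / 16.
    have := cmod_resolvent_le (ltW (N0 j)) (w_ge0 z).
    rewrite /N -mulrA mulrAC ler_pdivrMr// mul1r; lra.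
  have h2 := ler_wpM2r (cmod_ge0 (resolvent (N j) (w z))) (a_le j z).
  by have := tauS j; have := tau0 j; rewrite /B; lra.
have B0 j : 0 <= B j by rewrite /B mulr_ge0// ltW.
have Bsmall e : 0 < e -> exists j, B j < e.
  move=> e0; have [||j Hj] := @geometric_small R 256^-1 e => //; first lra.
  exists j; have := tau_le j; have := tau0 j; rewrite /B; lra.
have [g Ag Hg] := algebra_limit A_uniform Aa aB B0 Bsmall.
exists g, y; split=> // [z|j|j].
- apply/ler_addgt0Pr => e e0; have [|j Bj] := Bsmall (e / 2); first lra.
  have := cmodD (g z - a j z) (a j z); rewrite subrK.
  by have := a_le j z; have := Hg j z; rewrite mulr2n; lra.
- by rewrite tau0 tau_le.
(* In units of tau_j, the limit differs from [a j] by at most 9/32, and [theta_near] with N_j tau_j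
   = 16 costs 16/100; the sum is below 1/2. *)
- apply: le_trans (cmod_triangle _ (a j (y j)) _) _.
  rewrite (_ : a j _ - _ = w (y j) * (theta j (y j) - (-1) ^+ j)); last first.
    by rewrite /a; ring.
  rewrite cmodM; have := theta_near j (y j); have := Hg j (y j).
  rewrite -/(tau j) /N divfK ?gt_eqF// /B mulr2n; have := tau0 j.
  move: (cmod _) (cmod _) (tau j) => p q t; nra.
Qed.

End Oscillation.

(** Lets a single radius serve finitely many functions. The minimum starts from 1, which covers m =
    0. *)
Lemma common_radius (R : realType) (m : nat) (P : 'I_m -> R -> Prop) :
  (forall i d d', d' <= d -> P i d -> P i d') ->
  (forall i, exists2 d, 0 < d & P i d) -> exists2 d, 0 < d & forall i, P i d.
Proof.
move=> Pmono /fin_all_exists2[d d0 Pd].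
exists (\big[Num.min/1]_i d i); first by apply/lt_bigmin.
by move=> i; apply: Pmono (Pd i); exact: bigmin_le.
Qed.

(** * Failure of coherence at a peak point *)

Section Noncoherence.
Variables (R : realType) (X : Type) (A : set (X -> Cplx R)).
Hypothesis A_subring : subring_closed [in A].
Hypothesis A_scaler : GRing.scaler_closed [in A].
Hypothesis A_uniform : forall F : X -> Cplx R,
  (forall e : R, 0 < e -> exists2 a, A a & forall y, cmod (F y - a y) <= e) ->
  A F.
Variables (w : X -> Cplx R) (x : X).
Hypothesis Aw : A w.
Hypothesis w_ge0 : forall y, 0 <= cre (w y).
Hypothesis w_disc : forall y, cmod (1 - w y) <= 1.
(** The sets |w| < d take the place of neighbourhoods of [x], so again [X] carries no topology. *)
Hypothesis A_continuous : forall a, A a -> forall e : R, 0 < e ->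
  exists2 d, 0 < d & forall y, cmod (w y) < d -> cmod (a y - a x) < e.
Hypothesis w_nonzero_small : forall e : R, 0 < e -> exists y, 0 < cmod (w y) < e.

Let q (j : nat) : R := 2^-1 ^+ j.

Let q_gt0 j : 0 < q j. Proof. by rewrite exprn_gt0 ?invr_gt0. Qed.

Let qS j : q j.+1 = q j / 2. Proof. by rewrite /q exprS mulrC. Qed.

Let q_small e : 0 < e -> exists j, q j < e.
Proof. by move=> e0; apply: geometric_small => //; lra. Qed.

(** The first doubling of q_J is the sum of the tail 2^-J + 2^-(J+1) + ...; the second is the one
    from [algebra_limit]. *)
Lemma dyadic_series (F : nat -> X -> Cplx R) :
  (forall j, A (F j)) -> (forall j y, cmod (F j y) <= q j) ->
  exists2 f, A f &
    forall J y, cmod (f y - \sum_(j < J) F j y) <= q J *+ 2 *+ 2.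
Proof.
move=> AF Fq.
apply: (@algebra_limit _ _ _ A_uniform (fun J y => \sum_(j < J) F j y)
  (fun J => q J *+ 2)) => [J|J y|J|e e0].
- exact: (@algebra_sum _ _ _ A_subring J F).
- rewrite big_ord_recr addrAC subrr add0r; apply: le_trans (Fq J y) _.
  by rewrite /= qS; lra.
- by rewrite mulrn_wge0// ltW.
- have [|J qJ] := @q_small (e / 2); first lra.
  by exists J; rewrite mulr2n; lra.
Qed.

(* Along y_j the quotient g / w has the two limit values 1 and -1, up to 1/2. *)
Lemma vanishing_multiplier (g k a : X -> Cplx R) (y : nat -> X) :
  A k -> A a -> (forall j, 0 < cmod (w (y j)) <= (256^-1) ^+ j) ->
  (forall j, cmod (g (y j) - (-1) ^+ j * w (y j)) <= cmod (w (y j)) / 2) ->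
  (forall z, k z * g z = a z * w z) -> k x = 0.
Proof.
move=> Ak Aa y_lim g_osc kg.
apply: cmod_arbitrarily_small => e e0.
have e4 : 0 < e / 16 by lra.
have [d d0 Hk] := A_continuous Ak e4.
have [d' d'0 Ha] := A_continuous Aa e4.
have [||j Hj] := @geometric_small R 256^-1 (Num.min d d'); first lra.
  by rewrite lt_min d0.
have near i : (j <= i)%N -> cmod (w (y i)) < d /\ cmod (w (y i)) < d'.
  move=> ji; have /andP[_ yi] := y_lim i.
  apply/andP; rewrite -lt_min; apply: le_lt_trans Hj.
  by apply: le_trans yi _; rewrite ler_wiXn2l//; lra.
(* Dividing k g = a w by w at y_i compares a with (-1)^i k there; continuity moves the comparison to
   [x]. *)
have limit i : (j <= i)%N -> cmod (a x - (-1) ^+ i * k x) <= cmod (k x) / 2 + e / 4.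
  move=> ji; have [/Hk hk /Ha ha] := near i ji.
  have /andP[w0 _] := y_lim i; set z := y i in hk ha w0 *.
  have h : cmod (a z - (-1) ^+ i * k z) <= cmod (k z) / 2.
    rewrite -(ler_pM2r w0) -cmodM mulrBl -kg.
    rewrite (_ : _ - _ = k z * (g z - (-1) ^+ i * w z)); last ring.
    rewrite cmodM mulrAC -mulrA ler_wpM2l ?cmod_ge0//; exact: g_osc.
  have hk' : cmod ((-1) ^+ i * k z - (-1) ^+ i * k x) < e / 16.
    by rewrite -mulrBr cmodM cmodX cmodN cmod1 expr1n mul1r.
  have := cmod_triangle (a x) (a z) ((-1) ^+ i * k x).
  have := cmod_triangle (a z) ((-1) ^+ i * k z) ((-1) ^+ i * k x).
  have := cmodD (k z - k x) (k x); rewrite subrK (cmodB (a x) (a z)).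
  by lra.
(* An even and an odd index together give 2 |k(x)| <= |a(x) + k(x)| + |a(x) - k(x)| <= |k(x)| +
   e/2. *)
have := limit j.*2 ltac:(lia); have := limit j.*2.+1 ltac:(lia).
rewrite exprS -muln2 mulnC exprM sqrrN !expr1n mulr1 mul1r mulN1r opprK.
have := cmodD (a x + k x) (- (a x - k x)).
rewrite cmodN (_ : a x + k x - (a x - k x) = ofR 2 * k x); last first.
  by rewrite ofR2; ring.
by rewrite cmodM cmod_ofR ger0_norm//; lra.
Qed.

Lemma not_coherent_of_peak : w x = 0 -> ~ coherent (subring_of A_subring).
Proof.
move=> wx coh.
have [g [y [Ag g_le y_lim g_osc]]] :=
  oscillating_function A_subring A_scaler A_uniform Aw w_ge0 w_disc w_nonzero_small.
pose S := subring_of A_subring.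
pose mk f (Af : A f) : S := Sub f (mem_set Af).
have AS (s : S) : A (val s) by exact: set_mem (valP s).
pose principal (s : S) : set S := ideal_span (fun _ : 'I_1 => s).
have [m [W HW]] : finitely_generated (principal (mk w Aw) `&` principal (mk g Ag)).
  by apply: coh; [exists 1%N, (fun=> mk w Aw)|exists 1%N, (fun=> mk g Ag)].
have principalP (s r : S) : principal r s -> exists c, s = c * r.
  by move=> [c ->]; rewrite big_ord1; exists (c ord0).
have principal_mul (s r : S) : principal r (s * r).
  by exists (fun=> s); rewrite big_ord1.
have HWi i : (principal (mk w Aw) `&` principal (mk g Ag)) (W i).
  rewrite HW; exists (fun j => (j == i)%:R).
  rewrite (bigD1 i)//= eqxx mul1r big1 ?addr0// => j /negPf ->.
  by rewrite mul0r.
have /fin_all_exists[a Ha] : forall i, exists c, W i = c * mk w Aw.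
  by move=> i; apply: principalP; have [] := HWi i.
have /fin_all_exists[k Hk] : forall i, exists c, W i = c * mk g Ag.
  by move=> i; apply: principalP; have [] := HWi i.
have kx i : val (k i) x = 0.
  apply: (@vanishing_multiplier g _ (val (a i)) y) => // z.
  have : val (k i * mk g Ag) z = val (a i * mk w Aw) z by rewrite -Hk -Ha.
  by [].
(* The bound q_j^2 is of smaller order than the lower bound q_j / 2 obtained below for |h|. Dividing
   by m + 1 rather than m allows an empty family of generators. *)
have ex_z j : exists n, cmod (w (y n)) < q j ^+ 2 /\
    \sum_i cmod (val (k i) (y n)) <= q j ^+ 2.
  have e0 : 0 < q j ^+ 2 / m.+1%:R by rewrite divr_gt0 ?exprn_gt0.
  have [i d d' dd' H z zd'|i|d d0 Hd] := @common_radius R m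
      (fun i d => forall z, cmod (w z) < d ->
        cmod (val (k i) z) < q j ^+ 2 / m.+1%:R).
  - by apply: H; exact: lt_le_trans dd'.
  - have [d d0 H] := A_continuous (AS (k i)) e0.
    by exists d => // z /H; rewrite kx subr0.
  have [||n Hn] := @geometric_small R 256^-1 (Num.min d (q j ^+ 2)); first lra.
    by rewrite lt_min d0 exprn_gt0.
  have /andP[_ /le_lt_trans/(_ Hn)] := y_lim n.
  rewrite lt_min => /andP[yd yq]; exists n; split=> //.
  apply: (@le_trans _ _ (\sum_(i < m) q j ^+ 2 / m.+1%:R)).
    by apply: ler_sum => i _; apply: ltW; exact: Hd.
  rewrite sumr_const card_ord -[leLHS]mulr_natr mulrAC ler_pdivrMr//.
  by rewrite ler_wpM2l ?ler_nat// exprn_ge0 ?ltW.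
have [N HN] := choice ex_z.
pose z j := y (N j).
have z0 j : 0 < cmod (w (z j)) by have /andP[] := y_lim (N j).
(* This makes |e_{n_j}| <= 1/2 at z_j, so the j-th term of h has real part at least q_j / 2
   there. *)
pose n j := 2 / cmod (w (z j)).
have n0 j : 0 <= n j by rewrite divr_ge0 ?cmod_ge0.
have Ares j : A (fun p => resolvent (n j) (w p)) by exact: algebra_resolvent.
have [h Ah Hh] : exists2 f, A f & forall J p, cmod (f p -
    \sum_(j < J) ofR (q j) * (1 - resolvent (n j) (w p))) <= q J *+ 2 *+ 2.
  apply: (@dyadic_series (fun j p => ofR (q j) * (1 - resolvent (n j) (w p))))
    => [j|j p].
    by apply: algebraZ => //; apply: algebraB => //; exact: algebra1.
  rewrite cmodM cmod_ofR (ger0_norm (ltW (q_gt0 _))) ler_piMr ?(ltW (q_gt0 _))//.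
  exact: cmod_one_sub_resolvent_le1.
(* Since 1 - e_n = n w e_n, dividing g h by w termwise gives this series. Its terms are at most q_j
   because |g| <= |w| and n |w e_n| <= 1. *)
have [b Ab Hb] : exists2 f, A f & forall J p, cmod (f p -
    \sum_(j < J) ofR (q j * n j) * (g p * resolvent (n j) (w p))) <= q J *+ 2 *+ 2.
  apply: (@dyadic_series (fun j p => ofR (q j * n j) * (g p * resolvent (n j) (w p))))
    => [j|j p].
    by apply: algebraZ => //; exact: algebraM.
  have qj := ltW (q_gt0 j).
  rewrite 2!cmodM cmod_ofR (ger0_norm (mulr_ge0 qj (n0 j))) -mulrA ler_piMr//.
  apply: le_trans (cmod_resolvent_le (n0 j) (w_ge0 p)).
  by rewrite mulrA ler_wpM2r ?cmod_ge0// ler_wpM2l.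
have gh p : h p * g p = b p * w p.
  apply/eqP; rewrite -subr_eq0; apply/eqP; apply: cmod_arbitrarily_small => e e0.
  pose hJ J := \sum_(j < J) ofR (q j) * (1 - resolvent (n j) (w p)).
  pose bJ J := \sum_(j < J) ofR (q j * n j) * (g p * resolvent (n j) (w p)).
  have hb J : hJ J * g p = bJ J * w p.
    rewrite /hJ /bJ !mulr_suml; apply: eq_bigr => j _.
    by rewrite one_sub_resolvent// ofRM; ring.
  have wp : cmod (w p) <= 2.
    have := cmodD 1 (w p - 1); rewrite addrC subrK cmod1 cmodB.
    by have := w_disc p; lra.
  have [|J qJ] := @q_small (e / 16); first lra.
  rewrite (_ : _ - _ = (h p - hJ J) * g p - (b p - bJ J) * w p); last first.
    rewrite (mulrBl (g p)) (mulrBl (w p)) hb.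
    by move: (bJ J * w p) => u; ring.
  apply: le_trans (cmodD _ _) _; rewrite cmodN !cmodM.
  have hg : cmod (h p - hJ J) * cmod (g p) <= q J *+ 2 *+ 2 * 2.
    by apply: ler_pM; rewrite ?cmod_ge0 ?(le_trans (g_le p) wp)//; exact: Hh.
  have hw : cmod (b p - bJ J) * cmod (w p) <= q J *+ 2 *+ 2 * 2.
    by apply: ler_pM; rewrite ?cmod_ge0//; exact: Hb.
  by rewrite !mulr2n in hg hw; lra.
have : ideal_span W (mk h Ah * mk g Ag).
  rewrite -HW; split; last exact: principal_mul.
  rewrite (_ : _ * _ = mk b Ab * mk w Aw); first exact: principal_mul.
  by apply/val_inj/funext => p; exact: gh.
move=> [c Hc].
have h_eq j : h (z j) = \sum_i val (c i) (z j) * val (k i) (z j).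
  (* The oscillation estimate gives |g| >= |w| / 2 > 0 at z_j, so g can be cancelled. *)
  have gz : g (z j) != 0.
    rewrite -cmod_gt0; have := z0 j; have := g_osc (N j); rewrite -/(z j).
    have := cmodD (g (z j)) (- (g (z j) - (-1) ^+ N j * w (z j))).
    rewrite subKr cmodN cmodM cmodX cmodN cmod1 expr1n mul1r; lra.
  apply: (mulIf gz); rewrite mulr_suml.
  have -> : h (z j) * g (z j) = val (mk h Ah * mk g Ag) (z j) by [].
  rewrite Hc raddf_sum fct_sumE; apply: eq_bigr => i _.
  by rewrite Hk mulrA.
(* Every term of the series has nonnegative real part, so the j-th one alone bounds Re h from below.
   The cutoff J + j + 1 includes that term and leaves a small tail. *)
have h_ge j : q j / 2 <= cmod (h (z j)).
  apply/ler_addgt0Pr => e e0.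
  have [|J qJ] := @q_small (e / 4); first lra.
  have jK : (j < J + j.+1)%N by lia.
  have qK : q (J + j.+1)%N <= q J.
    by rewrite /q ler_wiXn2l ?leq_addr//; lra.
  have res_ge0 i : 0 <= cre (1 - resolvent (n i) (w (z j))).
    rewrite creD creN cre1 subr_ge0 (le_trans (ler_norm _))//.
    by rewrite (le_trans (cre_le _))// cmod_resolvent_le1.
  have res_j : 2^-1 <= cre (1 - resolvent (n j) (w (z j))).
    have := cmod_resolvent_le (n0 j) (w_ge0 (z j)).
    rewrite /n divfK ?gt_eqF ?z0// creD creN cre1.
    have := cre_le (resolvent (n j) (w (z j))).
    by have := ler_norm (cre (resolvent (n j) (w (z j)))); rewrite /n; lra.
  have sum_ge : q j / 2 <=
      cre (\sum_(i < J + j.+1) ofR (q i) * (1 - resolvent (n i) (w (z j)))).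
    rewrite (big_morph _ (@creD R) (erefl (cre 0))) (bigD1 (Ordinal jK))//=.
    rewrite creMl; have := ler_wpM2l (ltW (q_gt0 j)) res_j.
    move=> /le_trans; apply; rewrite lerDl sumr_ge0// => i _.
    by rewrite creMl mulr_ge0// ltW.
  have := Hh (J + j.+1)%N (z j); rewrite -!mulrnA -mulr_natr.
  set H := \sum_(i < _) _ in sum_ge *.
  have := ler_norm (cre (h (z j))); have := cre_le (h (z j)).
  have := ler_norm (- cre (h (z j) - H)); have := cre_le (h (z j) - H).
  rewrite normrN creD creN; lra.
(* The coefficients c_i are bounded near [x], uniformly in i. *)
have [i d d' dd' H p pd'|i|d d0 Hd] := @common_radius R m
    (fun i d => forall p, cmod (w p) < d ->
      cmod (val (c i) p) <= cmod (val (c i) x) + 1).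
- by apply: H; exact: lt_le_trans dd'.
- have [d d0 H] := A_continuous (AS (c i)) ltr01.
  exists d => // p /H; have := cmodD (val (c i) p - val (c i) x) (val (c i) x).
  by rewrite subrK; lra.
pose C := \sum_i (cmod (val (c i) x) + 1).
have C0 : 0 <= C by apply: sumr_ge0 => i _; rewrite addr_ge0 ?cmod_ge0.
(* The bounds 1 and d put z_j, where |w| < q_j^2 <= q_j, into the region just found; the last one
   yields C q_j^2 < q_j / 2. *)
have [|j] := @q_small (Num.min (Num.min 1 d) (2 * (C + 1))^-1).
  by rewrite !lt_min ltr01 d0 invr_gt0; lra.
rewrite !lt_min -andbA => /and3P[q1 qd qC].
have q2 : q j ^+ 2 <= q j by rewrite expr2 ler_piMr ?ltW.
have [wz kz] := HN j.
have : cmod (h (z j)) <= C * q j ^+ 2.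
  rewrite h_eq; apply: le_trans (cmod_sum _ _ _) _.
  apply: le_trans (ler_wpM2l C0 kz); rewrite mulr_sumr; apply: ler_sum => i _.
  rewrite cmodM ler_wpM2r ?cmod_ge0//; apply: (@le_trans _ _ (cmod (val (c i) x) + 1)).
    by apply: Hd; lra.
  by rewrite /C (bigD1 i)//= lerDl sumr_ge0// => ? _; rewrite addr_ge0 ?cmod_ge0.
have := h_ge j; have := q_gt0 j.
rewrite -[X in _ < X]mul1r ltr_pdivlMr in qC; last lra.
nra.
Qed.

End Noncoherence.

(** * A peaking polynomial *)

Section Euclid.
Variables (R : realType) (n : nat).
Implicit Types (x z : 'rV[Cplx R]_n).

Definition sqnorm z : R := \sum_i cmod (z ord0 i) ^+ 2.

(** The conjugate falls on [x], which makes this a polynomial in [z]. *)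
Definition inner z x : Cplx R := \sum_i complex.conjc (x ord0 i) * z ord0 i.

Lemma sqnorm_ge0 z : 0 <= sqnorm z.
Proof. by apply: sumr_ge0 => i _; exact: sqr_ge0. Qed.

Lemma sqr_coord_le z i : cmod (z ord0 i) ^+ 2 <= sqnorm z.
Proof.
by rewrite /sqnorm (bigD1 i)//= lerDl sumr_ge0// => j _; exact: sqr_ge0.
Qed.

(** A form of Cauchy-Schwarz by 2ab <= a^2 + b^2; for |z| <= |x| it still gives the sharp bound
    |x|^2. *)
Lemma cmod_inner_le z x : cmod (inner z x) *+ 2 <= sqnorm z + sqnorm x.
Proof.
rewrite /sqnorm -big_split /=.
apply: le_trans
  (_ : _ <= (\sum_i cmod (x ord0 i) * cmod (z ord0 i)) *+ 2) _.
  rewrite lerMn2r /=; apply: le_trans (cmod_sum _ _ _) _.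
  by apply: ler_sum => i _; rewrite cmodM /cmod normcJ.
rewrite -sumrMnl; apply: ler_sum => i _.
have := sqr_ge0 (cmod (z ord0 i) - cmod (x ord0 i)).
by rewrite sqrrB mulrC; lra.
Qed.

Lemma sqnormB z x : sqnorm (z - x) = sqnorm z + sqnorm x - cre (inner z x) *+ 2.
Proof.
rewrite /inner (big_morph _ (@creD R) (erefl (cre 0))) /sqnorm -sumrMnl.
rewrite -big_split -sumrB; apply: eq_bigr => i _; rewrite !mxE !sqr_cmod.
by case: (z _ _) => a b; case: (x _ _) => c d; rewrite /cre /=; ring.
Qed.

(* A function peaking on a closed Euclidean ball exactly at its boundary point
   x is 1 - supporting_function x. For x = 0 the inverse is the junk value 0 and
   the function vanishes, which is harmless as the ball is then {0}. *)
Definition supporting_function x z : Cplx R :=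
  ofR (sqnorm x *+ 2)^-1 * (ofR (sqnorm x) - inner z x).

Lemma cre_supporting x z : cre (supporting_function x z) =
  (sqnorm x *+ 2)^-1 * (sqnorm x - cre (inner z x)).
Proof. by rewrite creMl creD creN. Qed.

(** With r = |x|^2 > 0 and s the inner product, w = (r - s) / (2r), and the inequality reduces to
    |s|^2 <= r^2. *)
Lemma supporting_disc x z : sqnorm z <= sqnorm x ->
  cmod (supporting_function x z) ^+ 2 <= cre (supporting_function x z).
Proof.
move=> zx; have x0 := sqnorm_ge0 x.
rewrite cre_supporting cmodM cmod_ofR exprMn real_normK ?num_real// sqr_cmod.
rewrite creD creN cimD (_ : complex.Im (- _) = - complex.Im (inner z x)); last first.
  by case: (inner z x).
rewrite (_ : complex.Im (ofR _) = 0)// add0r sqrrN.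
have := cmod_inner_le z x; have := sqr_cmod (inner z x).
have := cmod_ge0 (inner z x); move: x0 zx; rewrite (_ : cre (ofR _) = sqnorm x)//.
move: (sqnorm x) (sqnorm z) (cmod _) (cre _) (complex.Im _) => r s m a b.
rewrite le_eqVlt => /orP[/eqP <-|r0]; first by rewrite mul0rn invr0 expr0n !mul0r.
move=> sr m0 mab msr.
have m2 : m ^+ 2 <= r ^+ 2 by rewrite lerXn2r ?nnegrE//; lra.
rewrite expr2 -mulrA ler_pM2l ?invr_gt0 ?mulrn_wgt0// ler_pdivrMl ?mulrn_wgt0//.
nra.
Qed.

(** Turns smallness of w into Euclidean closeness to [x], by |z - x|^2 <= 2 (|x|^2 - Re s) with s
    the inner product. *)
Lemma supporting_sqnormB x z : sqnorm z <= sqnorm x ->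
  sqnorm (z - x) <= 4 * sqnorm x * cre (supporting_function x z).
Proof.
move=> zx; rewrite sqnormB cre_supporting.
have := sqnorm_ge0 x; rewrite le_eqVlt => /orP[/eqP x0|x0].
  have := cmod_inner_le z x; have := cre_le (inner z x); have := sqnorm_ge0 z.
  have := ler_norm (- cre (inner z x)); rewrite normrN -x0 mulr2n; nra.
rewrite (_ : 4 * _ * _ = (sqnorm x - cre (inner z x)) *+ 2); first lra.
by field; lra.
Qed.

Definition supporting_poly x : mpoly.mpoly n (Cplx R) :=
  mpoly.mpolyC n (ofR (sqnorm x *+ 2)^-1) * (mpoly.mpolyC n (ofR (sqnorm x)) -
    \sum_i mpoly.mpolyC n (complex.conjc (x ord0 i)) *
           mpoly.mpolyX _ (mpoly.mnm1 i)).

Lemma peval_supporting x z :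
  peval (supporting_poly x) z = supporting_function x z.
Proof.
rewrite /peval /supporting_function mpoly.mevalM mpoly.mevalB !mpoly.mevalC.
rewrite (raddf_sum (mpoly.meval (z ord0))); congr (_ * (_ - _)).
by apply: eq_bigr => i _; rewrite /= mpoly.mevalM mpoly.mevalC mpoly.mevalXU.
Qed.

(** Guarantees that the suprema defining the hull are taken over bounded sets. From |z_i|^2 <= b one
    gets |z_i| <= 1 + b. *)
Lemma cmod_peval_bounded (q : mpoly.mpoly n (Cplx R)) (b : R) :
  exists M, forall z, sqnorm z <= b -> cmod (peval q z) <= M.
Proof.
exists (\sum_(m <- mpoly.msupp q)
  cmod (mpoly.mcoeff m q) * \prod_i (1 + b) ^+ mpoly.fun_of_multinom m i) => z zb.
rewrite /peval mpoly.mevalE; apply: le_trans (cmod_sum _ _ _) _.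
apply: ler_sum => m _; rewrite cmodM ler_wpM2l ?cmod_ge0// cmod_prod.
apply: ler_prod => i _; rewrite cmod_ge0 cmodX lerXn2r ?nnegrE ?cmod_ge0//.
  by have := sqnorm_ge0 z; lra.
have := sqr_coord_le z i; have := cmod_ge0 (z ord0 i); nra.
Qed.

End Euclid.

(** * Neighbourhoods and continuity in terms of real radii *)

Section Continuity.
Variables (R : realType) (n : nat).

(** Balls have radii in [Cplx R]; a positive one has zero imaginary part and can be replaced by its
    real part. *)
Lemma nbhs_cmod (u : Cplx R) (P : set (Cplx R)) :
  nbhs u P <-> exists2 e : R, 0 < e & forall v, cmod (v - u) < e -> P v.
Proof.
split=> [/nbhs_ballP[e /= e0 eP]|[e e0 eP]].
  have : 0 < e by []. rewrite ltcE => /andP[/eqP ie re].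
  exists (cre e) => // v uv; apply: eP; rewrite -ball_normE /=.
  by rewrite distrC ltcE; apply/andP; split; [rewrite ie|exact: uv].
apply/nbhs_ballP; exists (ofR e); first by rewrite /= ltcR.
move=> v; rewrite -ball_normE /= distrC => uv; apply: eP.
by move: uv; rewrite norm_cmod ltcR.
Qed.

Lemma continuous_cmod : continuous (@cmod R).
Proof.
move=> u P /nbhs_ballP[e /= e0 eP]; apply/nbhs_cmod; exists e => // v uv.
apply: eP; rewrite -ball_normE /=.
have := cmod_triangle u v 0; have := cmod_triangle v u 0; rewrite !subr0 (cmodB u).
by rewrite ltr_norml; lra.
Qed.

Lemma continuous_sqnorm : continuous (@sqnorm R n).
Proof.
apply: continuous_big => [|i _ z]; first exact: add_continuous.
have ci : cmod (u ord0 i) @[u --> z] --> cmod (z ord0 i).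
  apply: (@cvg_comp _ _ _ (fun u => u ord0 i) (@cmod R)); last exact: continuous_cmod.
  exact: coord_continuous.
exact: (cvgM ci ci).
Qed.

Lemma continuous_inner (x : 'rV[Cplx R]_n) : continuous (fun z => inner z x).
Proof.
apply: continuous_big => [|i _ z]; first exact: add_continuous.
have ci : u ord0 i @[u --> z] --> z ord0 i by exact: coord_continuous.
exact: (cvgM (cvg_cst _) ci).
Qed.

Lemma continuous_supporting (x : 'rV[Cplx R]_n) :
  continuous (supporting_function x).
Proof.
move=> z; have ci := @continuous_inner x z.
exact: (cvgM (cvg_cst _) (cvgB (cvg_cst _) ci)).
Qed.

Lemma nbhs_sqnorm (x : 'rV[Cplx R]_n) (P : set 'rV[Cplx R]_n) :
  nbhs x P -> exists2 e : R, 0 < e & forall z, sqnorm (z - x) < e -> P z.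
Proof.
move=> /nbhs_ballP[e /= e0 eP]; have : 0 < e by [].
rewrite ltcE => /andP[/eqP ie re].
exists (cre e ^+ 2) => [|z zx]; first by rewrite exprn_gt0.
apply: eP; split=> // i j; rewrite -ball_normE /= distrC ltcE.
apply/andP; split; first by rewrite ie.
have := le_lt_trans (sqr_coord_le _ j) zx; rewrite !mxE (ord1 i).
by rewrite ltr_pXn2r ?nnegrE ?cmod_ge0 //; exact: (ltW re).
Qed.

End Continuity.

Lemma mem_poly_hull (R : realType) (n : nat) (K : set 'rV[Cplx R]_n) (b : R) :
  (forall z, K z -> sqnorm z <= b) -> K `<=` poly_hull K.
Proof.
move=> Kb x Kx q; have [M qM] := cmod_peval_bounded q b.
apply: ub_le_sup; last by exists x.
by exists M => _ [z /Kb/qM ? <-].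
Qed.

(** * The peak at a point of maximal norm *)

Section Peak.
Variables (R : realType) (n : nat) (K : set 'rV[Cplx R]_n) (x : 'rV[Cplx R]_n).
Hypothesis Kx : K x.
Hypothesis x_max : forall z, K z -> sqnorm z <= sqnorm x.
Let w := supporting_function x.

Lemma supporting_self : w x = 0.
Proof.
apply/eqP; rewrite -cmod_eq0; apply/eqP.
have := supporting_disc (lexx (sqnorm x)); rewrite -/w cre_supporting.
have -> : cre (inner x x) = sqnorm x.
  have := sqnormB x x; rewrite subrr /sqnorm big1 => [|i _]; first lra.
  by rewrite mxE cmod0 expr0n.
by rewrite subrr mulr0; have := cmod_ge0 (w x); nra.
Qed.

Lemma supporting_re_ge0 z : K z -> 0 <= cre (w z).
Proof. by move=> /x_max/supporting_disc; apply: le_trans; exact: sqr_ge0. Qed.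

(** Expand |1 - w|^2 = 1 - 2 Re w + |w|^2 and use |w|^2 <= Re w. *)
Lemma one_sub_supporting z : K z -> cmod (1 - w z) ^+ 2 <= 1 - cmod (w z) ^+ 2.
Proof.
move=> /x_max/supporting_disc; rewrite -/w !sqr_cmod creD creN cre1 cimD.
have -> : complex.Im (- w z) = - complex.Im (w z) by case: (w z).
rewrite add0r; nra.
Qed.

Lemma supporting_eq0 z : K z -> w z = 0 -> z = x.
Proof.
move=> Kz wz; apply/rowP => i.
have := supporting_sqnormB (x_max Kz); rewrite -/w wz mulr0 => zx.
apply/eqP; rewrite -subr_eq0 -cmod_eq0.
have := le_trans (sqr_coord_le (z - x) i) zx; rewrite !mxE.
by have := cmod_ge0 (z ord0 i - x ord0 i); nra.
Qed.

(* If |w| >= e on K \ {x}, then |1 - w| <= rho < 1 there, and the polynomials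
   (1 - w) ^ N (z_i - x_i) show that no point of the hull with |w| small differs
   from x. *)
Lemma isolated_peak (e : R) : 0 < e ->
  (forall z, K z -> cmod (w z) = 0 \/ e <= cmod (w z)) ->
  isolated (poly_hull K) x.
Proof.
move=> e0 gap; pose d := Num.min e 1.
have d0 : 0 < d by rewrite lt_min e0 ltr01.
have d1 : d <= 1 by rewrite ge_min lexx orbT.
have de : d <= e by rewrite ge_min lexx.
(* On K, |w| >= d gives |1 - w|^2 <= 1 - d^2 <= rho^2, whereas |w| < d^2 / 4 gives |1 - w| >= sigma;
   d <= 1 keeps rho nonnegative. *)
pose rho := 1 - d ^+ 2 / 2; pose sigma := 1 - d ^+ 2 / 4.
have rho0 : 0 <= rho by rewrite /rho; nra.
have rs : rho < sigma by rewrite /rho /sigma; have := exprn_gt0 2 d0; lra.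
have K_hull : K `<=` poly_hull K by exact: mem_poly_hull x_max.
split; first exact/mem_set/K_hull.
exists [set z | cmod (w z) < d ^+ 2 / 4].
  have wx : cmod (w u) @[u --> x] --> (0 : R).
    rewrite -(cmod0 R) -supporting_self.
    apply: (@cvg_comp _ _ _ w (@cmod R)); last exact: continuous_cmod.
    exact: continuous_supporting.
  have : \forall u \near (0 : R), u < d ^+ 2 / 4.
    by apply: lt_nbhsl; rewrite divr_gt0 ?exprn_gt0.
  by move=> /wx.
apply/seteqP; split => [z /= [wz hz]|_ ->]; last first.
  by split; [rewrite /= supporting_self cmod0 divr_gt0 ?exprn_gt0|exact: K_hull].
apply/rowP => i; apply/eqP; rewrite -subr_eq0; apply/eqP.
pose p (N : nat) : mpoly.mpoly n (Cplx R) := (1 - supporting_poly x) ^+ N *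
  (mpoly.mpolyX _ (mpoly.mnm1 i) - mpoly.mpolyC n (x ord0 i)).
have pE N u : peval (p N) u = (1 - w u) ^+ N * (u ord0 i - x ord0 i).
  rewrite /w -peval_supporting /peval mpoly.mevalM rmorphXn /= !mpoly.mevalB.
  by rewrite mpoly.meval1 mpoly.mevalXU mpoly.mevalC.
pose M : R := 2 * (1 + sqnorm x).
have M0 : 0 < M by rewrite /M; have := sqnorm_ge0 x; lra.
have coord u : K u -> cmod (u ord0 i) <= 1 + sqnorm x.
  move=> /x_max; have := sqr_coord_le u i; have := cmod_ge0 (u ord0 i); nra.
have p_le N u : K u -> cmod (peval (p N) u) <= rho ^+ N * M.
  move=> Ku; rewrite pE cmodM cmodX.
  have [w0|we] := gap u Ku.
    have /(supporting_eq0 Ku) -> : w u = 0 by apply/eqP; rewrite -cmod_eq0 w0.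
    by rewrite subrr cmod0 mulr0 mulr_ge0 ?exprn_ge0 ?(ltW M0).
  apply: ler_pM; rewrite ?exprn_ge0 ?cmod_ge0//.
    rewrite lerXn2r ?nnegrE ?cmod_ge0//.
    rewrite -(ler_pXn2r (n := 2)) ?nnegrE ?cmod_ge0//.
    apply: le_trans (one_sub_supporting Ku) _.
    have dw : d ^+ 2 <= cmod (w u) ^+ 2.
      by rewrite lerXn2r ?nnegrE ?cmod_ge0 ?(ltW d0)// (le_trans de).
    have -> : rho ^+ 2 = 1 - d ^+ 2 + (d ^+ 2) ^+ 2 / 4 by rewrite /rho; field.
    by have := sqr_ge0 (d ^+ 2); lra.
  have := cmodD (u ord0 i) (- x ord0 i); rewrite cmodN.
  by have := coord _ Ku; have := coord _ Kx; rewrite /M; lra.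
have sigma_le : sigma <= cmod (1 - w z).
  have := cmodD (1 - w z) (w z); rewrite subrK cmod1 /sigma; lra.
have s0 : 0 < sigma by exact: le_lt_trans rs.
(* The hull inequality for p_N; since rho < sigma, letting N grow forces z_i = x_i. *)
have hull_le N : sigma ^+ N * cmod (z ord0 i - x ord0 i) <= rho ^+ N * M.
  apply: le_trans (_ : cmod (peval (p N) z) <= _).
    rewrite pE cmodM cmodX ler_wpM2r ?cmod_ge0// lerXn2r ?nnegrE ?cmod_ge0//.
    exact: ltW.
  apply: le_trans (hz (p N)) _; apply: ge_sup.
    by exists (complex.Re `|peval (p N) x|), x.
  by move=> _ [u Ku <-]; exact: p_le.
apply: cmod_arbitrarily_small => t t0.
have [||N HN] := @geometric_small R (rho / sigma) (t / M).
- by rewrite divr_ge0 ?(ltW s0)//= ltr_pdivrMr ?mul1r.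
- by rewrite divr_gt0.
have := hull_le N; rewrite -ler_pdivlMl ?exprn_gt0//.
move=> /le_trans; apply; move: HN; rewrite ltr_pdivlMr// => /ltW.
by congr (_ <= _); rewrite expr_div_n [LHS]mulrAC [RHS]mulrC.
Qed.

End Peak.

(** * Application to uniform algebras on K *)

Lemma uniformly_closed_limit (R : realType) (n : nat) (K : set 'rV[Cplx R]_n)
    (A : set (K -> Cplx R)) (F : K -> Cplx R) : uniformly_closed A ->
  (forall e : R, 0 < e -> exists2 a, A a & forall y, cmod (F y - a y) <= e) ->
  A F.
Proof.
move=> A_closed FA; apply: A_closed => B /uniform_nbhs[E [entE EB]].
move: entE; rewrite -entourage_ballE => -[e /= e0 eE].
have : 0 < e by [].
rewrite ltcE => /andP[/eqP ie re].
(* Half the radius turns the weak inequality into the strict one. *)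
have [|a Aa Fa] := FA (cre e / 2); first by rewrite divr_gt0.
exists a; split=> //; apply: EB => y _; apply: eE; rewrite /= -ball_normE /=.
rewrite ltcE; apply/andP; split; first by rewrite ie.
by apply: le_lt_trans (Fa y) _; rewrite ltr_pdivrMr// ltr_pMr// ltr1n.
Qed.

Lemma nbhs_set_val (T : topologicalType) (K : set T) (x : K) (P : set K) :
  nbhs x P -> exists2 Q, nbhs (val x) Q & forall y : K, Q (val y) -> P y.
Proof.
rewrite nbhsE => -[_ [[Q oQ <-] Qx] QP].
by exists Q => [|y Qy]; [exists Q|exact: QP].
Qed.

Theorem theorem5p7 (R : realType) (n : nat) (K : set 'rV[Cplx R]_n)
    (K_nonempty : K !=set0) (K_compact : compact K)
    (hull_no_isolated : forall z, ~ isolated (poly_hull K) z)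
    (A : set (K -> Cplx R)) (A_subalgebra : subalgebra A)
    (A_closed : uniformly_closed A)
    (P_sub_A : P_of K `<=` A) (A_sub_C : A `<=` C_of K) :
  ~ coherent (subring_of A_subalgebra.1).
Proof.
have [x /set_mem Kx x_max'] := compact_EVT_max K_nonempty K_compact
  (continuous_subspaceT (@continuous_sqnorm R n)).
have {x_max'} x_max z : K z -> sqnorm z <= sqnorm x.
  by move=> Kz; apply: x_max'; exact: mem_set.
pose w (y : K) := supporting_function x (val y).
have Ky (y : K) : K (val y) by exact: set_mem (valP y).
have w_cont : continuous w.
  move=> y; apply: (@cvg_comp _ _ _ val (supporting_function x)).
    exact: initial_continuous.
  exact: continuous_supporting.
pose x' : K := exist _ x (mem_set Kx).
apply: (@not_coherent_of_peak R K A A_subalgebra.1 A_subalgebra.2 _ w x').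
- by move=> F; exact: uniformly_closed_limit.
- apply: P_sub_A; split=> //; apply: subset_closure.
  by exists (supporting_poly x) => y; rewrite peval_supporting.
- by move=> y; exact: supporting_re_ge0 x_max _ (Ky y).
- move=> y; have := one_sub_supporting x_max (Ky y).
  by have := sqr_ge0 (cmod (w y)); have := cmod_ge0 (1 - w y); nra.
- move=> a Aa e e0.
  have /A_sub_C/(_ x' [set v | cmod (v - a x') < e]) := Aa.
  move=> /(_ _)/nbhs_set_val[|Q Qx QP]; first by apply/nbhs_cmod; exists e.
  have [d d0 dQ] := nbhs_sqnorm Qx.
  (* By [supporting_sqnormB], |y - x|^2 <= 4 |x|^2 |w(y)|; adding 1 permits division when x = 0. *)
  have x0 : 0 < 4 * sqnorm x + 1 by have := sqnorm_ge0 x; lra.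
  exists (d / (4 * sqnorm x + 1)) => [|y]; first by rewrite divr_gt0.
  rewrite ltr_pdivlMr// => wd; apply/QP/dQ.
  apply: le_lt_trans (supporting_sqnormB (x_max _ (Ky y))) _.
  apply: le_lt_trans wd; rewrite mulrC.
  have := ler_norm (cre (w y)); have := cre_le (w y); have := cmod_ge0 (w y).
  by have := sqnorm_ge0 x; rewrite /w; nra.
(* Otherwise w is 0 or at least e in modulus on K, and [x] would be isolated in the hull. *)
- move=> e e0; apply/not_existsP => no.
  apply: (hull_no_isolated x); apply: (isolated_peak Kx x_max e0) => z Kz.
  have := no (exist _ z (mem_set Kz)); rewrite /w /=.
  have := cmod_ge0 (supporting_function x z); rewrite le_eqVlt => /orP[/eqP <-|->].
    by left.
  by move=> /negP; rewrite -leNgt; right.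
- exact: supporting_self.
Qed.
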